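(* In the setting described in the context, assume there exists $\bar Z\in\mathbb{R}^{(n+m)\times n}$ with $\begin{bmatrix} I\\ \bar Z\end{bmatrix}^\top N\begin{bmatrix} I\\ \bar Z\end{bmatrix}>0$, and let $\gamma>0$. Then the data $(U_-,X)$ are informative for $\mathcal{H}_2$ control with performance $\gamma$ if and only if there exist symmetric $Y\in\mathbb{R}^{n\times n}$ with $Y>0$, symmetric $Z\in\mathbb{R}^{n\times n}$, $L\in\mathbb{R}^{m\times n}$ and scalars $\alpha\ge0$, $\beta>0$ such that, with $C_{Y,L}:=CY+DL$, $$\begin{bmatrix} Y-\beta I & 0 & 0 & 0 & 0\\ 0 & 0 & 0 & Y & 0\\ 0 & 0 & 0 & L & 0\\ 0 & Y & L^\top & Y & C_{Y,L}^\top\\ 0 & 0 & 0 & C_{Y,L} & I\end{bmatrix}-\alpha\begin{bmatrix} I & X_+\\ 0 & -X_-\\ 0 & -U_-\\ 0 & 0\\ 0 & 0\end{bmatrix}\begin{bmatrix}\Phi_{11} & \Phi_{12}\\ \Phi_{12}^\top & \Phi_{22}\end{bmatrix}\begin{bmatrix} I & X_+\\ 0 & -X_-\\ 0 & -U_-\\ 0 & 0\\ 0 & 0\end{bmatrix}^\top\ge0$$ (block sizes $n,n,m,n,p$), $\begin{bmatrix} Y & C_{Y,L}^\top\\ C_{Y,L} & I\end{bmatrix}>0$, $\begin{bmatrix} Z & I\\ I & Y\end{bmatrix}\ge0$ and $\operatorname{tr} Z<\gamma^2$. Moreover, if $Y,L$ (with some $Z,\alpha,\beta$) satisfy these conditions,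 then $K:=LY^{-1}$ is such that, for all $(A,B)\in\Sigma$, $A+BK$ is Schur stable and the transfer matrix $G(z)=(C+DK)(zI-(A+BK))^{-1}$ satisfies $\|G\|_{\mathcal{H}_2}<\gamma$.
   Context: Consider the system $x(t+1)=A_sx(t)+B_su(t)+w(t)$ with unknown $A_s\in\mathbb{R}^{n\times n}$, $B_s\in\mathbb{R}^{n\times m}$ and unknown noise $w$, and a performance output $z(t)=Cx(t)+Du(t)$ with known $C\in\mathbb{R}^{p\times n}$, $D\in\mathbb{R}^{p\times m}$. Data: $X_+=[x(1)\ \cdots\ x(T)]$, $X_-=[x(0)\ \cdots\ x(T-1)]$, $U_-=[u(0)\ \cdots\ u(T-1)]$, with $X_+=A_sX_-+B_sU_-+W_-$ where $W_-=[w(0)\ \cdots\ w(T-1)]$ satisfies $\begin{bmatrix} I\\ W_-^\top\end{bmatrix}^\top\begin{bmatrix}\Phi_{11} & \Phi_{12}\\ \Phi_{12}^\top & \Phi_{22}\end{bmatrix}\begin{bmatrix} I\\ W_-^\top\end{bmatrix}\ge0$ for known $\Phi_{11}=\Phi_{11}^\top\in\mathbb{R}^{n\times n}$, $\Phi_{12}\in\mathbb{R}^{n\times T}$, $\Phi_{22}=\Phi_{22}^\top\in\mathbb{R}^{T\times T}$, $\Phi_{22}<0$. $\Sigma$ is the set of all $(A,B)$ such that $X_+=AX_-+BU_-+W$ for some $W\in\mathbb{R}^{n\times T}$ satisfying the same noise inequality. $N:=\begin{bmatrix} I & X_+\\ 0 & -X_-\\ 0 & -U_-\end{bmatrix}\begin{bmatrix}\Phi_{11}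 & \Phi_{12}\\ \Phi_{12}^\top & \Phi_{22}\end{bmatrix}\begin{bmatrix} I & X_+\\ 0 & -X_-\\ 0 & -U_-\end{bmatrix}^\top$. The data are informative for $\mathcal{H}_2$ control with performance $\gamma$ if there exist symmetric $P>0$ and $K\in\mathbb{R}^{m\times n}$ such that for all $(A,B)\in\Sigma$: $P>(A+BK)^\top P(A+BK)+(C+DK)^\top(C+DK)$ and $\operatorname{tr}P<\gamma^2$. *)

(* Defs.v *)
From HB Require Import structures.
From mathcomp Require Import all_boot all_order all_algebra.
From mathcomp Require Import all_classical all_reals all_analysis.
From mathcomp Require Import complex.
Set Implicit Arguments. Unset Strict Implicit. Unset Printing Implicit Defensive.
Import Order.TTheory GRing.Theory Num.Theory.
Import numFieldNormedType.Exports.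
Local Open Scope ring_scope.

Section Defs.
Variable R : realType.

Definition sym_mx (k : nat) (M : 'M[R]_k) : Prop := M^T = M.

Definition posdef (k : nat) (M : 'M[R]_k) : Prop :=
  sym_mx M /\ forall x : 'cV[R]_k, x != 0 -> 0 < (x^T *m M *m x) 0 0.

Definition psd (k : nat) (M : 'M[R]_k) : Prop :=
  sym_mx M /\ forall x : 'cV[R]_k, 0 <= (x^T *m M *m x) 0 0.

Definition negdef (k : nat) (M : 'M[R]_k) : Prop := posdef (- M).

Definition Phi_mx (n T : nat) (Phi11 : 'M[R]_n) (Phi12 : 'M[R]_(n, T))
  (Phi22 : 'M[R]_T) : 'M[R]_(n + T) :=
  block_mx Phi11 Phi12 Phi12^T Phi22.

Definition noise_ok (n T : nat) (Phi11 : 'M[R]_n) (Phi12 : 'M[R]_(n, T))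
  (Phi22 : 'M[R]_T) (W : 'M[R]_(n, T)) : Prop :=
  psd ((col_mx 1%:M W^T)^T *m Phi_mx Phi11 Phi12 Phi22 *m col_mx 1%:M W^T).

Definition Sigma (n m T : nat) (Phi11 : 'M[R]_n) (Phi12 : 'M[R]_(n, T))
  (Phi22 : 'M[R]_T) (Xp Xm : 'M[R]_(n, T)) (Um : 'M[R]_(m, T))
  (A : 'M[R]_n) (B : 'M[R]_(n, m)) : Prop :=
  exists W : 'M[R]_(n, T),
    Xp = A *m Xm + B *m Um + W /\ noise_ok Phi11 Phi12 Phi22 W.

Definition data_mx (n m T : nat) (Xp Xm : 'M[R]_(n, T)) (Um : 'M[R]_(m, T))
  : 'M[R]_(n + (n + m), n + T) :=
  col_mx (row_mx 1%:M Xp) (col_mx (row_mx 0 (- Xm)) (row_mx 0 (- Um))).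

Definition Nmx (n m T : nat) (Phi11 : 'M[R]_n) (Phi12 : 'M[R]_(n, T))
  (Phi22 : 'M[R]_T) (Xp Xm : 'M[R]_(n, T)) (Um : 'M[R]_(m, T))
  : 'M[R]_(n + (n + m)) :=
  data_mx Xp Xm Um *m Phi_mx Phi11 Phi12 Phi22 *m (data_mx Xp Xm Um)^T.

Definition informative_H2 (n m p T : nat) (Phi11 : 'M[R]_n)
  (Phi12 : 'M[R]_(n, T)) (Phi22 : 'M[R]_T) (Xp Xm : 'M[R]_(n, T))
  (Um : 'M[R]_(m, T)) (C : 'M[R]_(p, n)) (D : 'M[R]_(p, m)) (gamma : R)
  : Prop :=
  exists (P : 'M[R]_n) (K : 'M[R]_(m, n)),
    posdef P /\
    (forall A B, Sigma Phi11 Phi12 Phi22 Xp Xm Um A B ->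
       posdef (P - ((A + B *m K)^T *m P *m (A + B *m K)
                    + (C + D *m K)^T *m (C + D *m K)))) /\
    \tr P < gamma ^+ 2.

Definition lmi_mx (n m p : nat) (C : 'M[R]_(p, n)) (D : 'M[R]_(p, m))
  (Y : 'M[R]_n) (L : 'M[R]_(m, n)) (beta : R)
  : 'M[R]_((n + (n + m)) + (n + p)) :=
  let CYL := C *m Y + D *m L in
  let UR : 'M[R]_(n + (n + m), n + p) :=
    col_mx (0 : 'M[R]_(n, n + p)) (row_mx (col_mx Y L) (0 : 'M[R]_(n + m, p))) in
  block_mx (block_mx (Y - beta%:M) 0 0 0) UR UR^T (block_mx Y CYL^T CYL 1%:M).

Definition data_mx5 (n m p T : nat) (Xp Xm : 'M[R]_(n, T)) (Um : 'M[R]_(m, T))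
  : 'M[R]_((n + (n + m)) + (n + p), n + T) :=
  col_mx (data_mx Xp Xm Um) 0.

Definition schur_stable (n : nat) (A : 'M[R]_n) : Prop :=
  forall lambda : R[i],
    eigenvalue (map_mx (fun x : R => (x%:C)%C) A) lambda -> `|lambda| < 1.

(* H2 norm of G(z) = Cc (zI - Ac)^{-1}: square root of the sum of the
   squared Frobenius norms of the impulse response coefficients
   Cc Ac^k, k >= 0 *)
Definition h2_terms (n p : nat) (Ac : 'M[R]_n) (Cc : 'M[R]_(p, n)) : R^nat :=
  fun k => \tr (Cc *m Ac ^+ k *m (Cc *m Ac ^+ k)^T).

Definition h2norm (n p : nat) (Ac : 'M[R]_n) (Cc : 'M[R]_(p, n)) : R :=
  Num.sqrt (limn (series (h2_terms Ac Cc))).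

End Defs.

(* Main.v *)
Require Import Defs.
From HB Require Import structures.
From mathcomp Require Import all_boot all_order all_algebra.
From mathcomp Require Import all_classical all_reals all_analysis.
From mathcomp Require Import complex.
From mathcomp Require Import ring lra.
Import Order.TTheory GRing.Theory Num.Theory.
Local Open Scope ring_scope.

(* Testing the LMI on the vector (q; A^T q; B^T q; -P x; (C + D K) x) with
   P = Y^-1 and q = P (A + B K) x gives the Lyapunov inequality for every
   consistent (A, B); stability and the H2 bound follow by telescoping.

   Conversely, a pair (q, r) on which the form of N is nonnegative extends to a
   consistent (A, B) with [A B]^T q = r, so the Lyapunov inequality, in its dual
   form, says that q^T Y q - e^T Q^-1 e > 0 with e = r_1 + K^T r_2 and
   Q = P - (C + D K)^T (C + D K).  Since e depends on r only through the data,
   both forms live on the range of (q, r) |-> (q, X_+^T q - X_-^T r_1 - U_-^T r_2),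
   where Phi_22 < 0 makes the inequality strict on a compact set.  The strict
   S-lemma there yields alpha and beta. *)

(** * Inner products and definite matrices *)

Section Dot.
Set Implicit Arguments.
Unset Strict Implicit.
Context {R : realType}.

Definition dot {k} (x y : 'cV[R]_k) : R := (x^T *m y) 0 0.

Lemma dotE k (x y : 'cV[R]_k) : dot x y = \sum_i x i 0 * y i 0.
Proof. by rewrite /dot mxE; apply: eq_bigr => i _; rewrite mxE. Qed.

Lemma dotC k (x y : 'cV[R]_k) : dot x y = dot y x.
Proof. by rewrite !dotE; apply: eq_bigr => i _; rewrite mulrC. Qed.

Lemma dotDl k (x y z : 'cV[R]_k) : dot (x + y) z = dot x z + dot y z.
Proof. by rewrite /dot linearD /= mulmxDl mxE. Qed.

Lemma dotDr k (x y z : 'cV[R]_k) : dot z (x + y) = dot z x + dot z y.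
Proof. by rewrite /dot mulmxDr mxE. Qed.

Lemma dotNl k (x z : 'cV[R]_k) : dot (- x) z = - dot x z.
Proof. by rewrite /dot linearN /= mulNmx mxE. Qed.

Lemma dotNr k (x z : 'cV[R]_k) : dot z (- x) = - dot z x.
Proof. by rewrite /dot mulmxN mxE. Qed.

Lemma dotZl k a (x z : 'cV[R]_k) : dot (a *: x) z = a * dot x z.
Proof. by rewrite /dot linearZ /= -scalemxAl mxE. Qed.

Lemma dotZr k a (x z : 'cV[R]_k) : dot z (a *: x) = a * dot z x.
Proof. by rewrite /dot -scalemxAr mxE. Qed.

Lemma dot0l k (x : 'cV[R]_k) : dot 0 x = 0.
Proof. by rewrite /dot linear0 mul0mx mxE. Qed.

Lemma dot0r k (x : 'cV[R]_k) : dot x 0 = 0.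
Proof. by rewrite /dot mulmx0 mxE. Qed.

Definition dot_lin := (@dotDl, @dotDr, @dotNl, @dotNr, @dotZl, @dotZr).

Lemma dot_mulmx j k (A : 'M[R]_(j, k)) (x : 'cV_k) (y : 'cV_j) :
  dot (A *m x) y = dot x (A^T *m y).
Proof. by rewrite /dot trmx_mul mulmxA. Qed.

Lemma dot_sym_mx k (M : 'M[R]_k) (x y : 'cV_k) :
  sym_mx M -> dot x (M *m y) = dot y (M *m x).
Proof. by move=> Ms; rewrite dotC dot_mulmx Ms. Qed.

Lemma quad_dot k (M : 'M[R]_k) (x : 'cV_k) :
  (x^T *m M *m x) 0 0 = dot x (M *m x).
Proof. by rewrite /dot mulmxA. Qed.

Lemma dot_col_mx j k (a c : 'cV[R]_j) (b d : 'cV_k) :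
  dot (col_mx a b) (col_mx c d) = dot a c + dot b d.
Proof. by rewrite /dot tr_col_mx mul_row_col mxE. Qed.

Lemma dot_ge0 k (x : 'cV[R]_k) : 0 <= dot x x.
Proof. by rewrite dotE; apply: sumr_ge0 => i _; rewrite -expr2 sqr_ge0. Qed.

Lemma dot_eq0 k (x : 'cV[R]_k) : dot x x = 0 -> x = 0.
Proof.
rewrite dotE => /eqP; rewrite psumr_eq0; last by move=> i _; rewrite -expr2 sqr_ge0.
move=> /allP x0; apply/matrixP => i j; rewrite ord1 mxE.
by have := x0 i (mem_index_enum _); rewrite -expr2 sqrf_eq0 => /eqP.
Qed.

Lemma dot_gt0 k (x : 'cV[R]_k) : x != 0 -> 0 < dot x x.
Proof.
move=> x0; rewrite lt_def dot_ge0 andbT.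
by apply: contra_neq x0 => /dot_eq0.
Qed.

Lemma posdefP k (M : 'M[R]_k) :
  posdef M <-> sym_mx M /\ forall x : 'cV_k, x != 0 -> 0 < dot x (M *m x).
Proof.
by split=> -[Ms Mp]; split=> // x x0; have := Mp x x0; rewrite quad_dot.
Qed.

Lemma psdP k (M : 'M[R]_k) :
  psd M <-> sym_mx M /\ forall x : 'cV_k, 0 <= dot x (M *m x).
Proof. by split=> -[Ms Mp]; split=> // x; have := Mp x; rewrite quad_dot. Qed.

Lemma posdef_quad_ge0 k (M : 'M[R]_k) (x : 'cV_k) :
  posdef M -> 0 <= dot x (M *m x).
Proof.
move=> /posdefP[_ Mp]; have [->|/Mp/ltW//] := eqVneq x 0.
by rewrite dot0l.
Qed.

Lemma posdef_unitmx k (M : 'M[R]_k) : posdef M -> M \in unitmx.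
Proof.
move=> /posdefP[Ms Mp]; rewrite -row_free_unit -kermx_eq0.
apply/negPn/negP => /rowV0Pn[v /sub_kermxP vM v0].
have : v^T != 0 by rewrite -trmx0 (inj_eq trmx_inj).
by move=> /Mp; rewrite -[M]Ms -trmx_mul vM trmx0 dot0r ltxx.
Qed.

Lemma sym_invmx k (M : 'M[R]_k) : sym_mx M -> sym_mx (invmx M).
Proof. by rewrite /sym_mx trmx_inv => ->. Qed.

Lemma posdef_invmx k (M : 'M[R]_k) : posdef M -> posdef (invmx M).
Proof.
move=> Mp; have Mu := posdef_unitmx Mp.
move: Mp => /posdefP[Ms Mp]; apply/posdefP; split; first exact: sym_invmx.
move=> x x0; have xE : x = M *m (invmx M *m x) by rewrite mulKVmx.
rewrite {1}xE dotC dot_sym_mx // mulKVmx // dotC {1}xE dotC; apply: Mp.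
by apply: contra_neq x0 => y0; rewrite xE y0 mulmx0.
Qed.

(** Each column of [cokermx B] is killed by [B], hence by [A], so [A *m cokermx B = 0], which is the
    row space inclusion. *)
Lemma submx_ker j k l (A : 'M[R]_(j, l)) (B : 'M[R]_(k, l)) :
  (forall x : 'cV_l, B *m x = 0 -> A *m x = 0) -> (A <= B)%MS.
Proof.
move=> kerBA; rewrite submxE; apply/eqP/matrixP => i c.
have : A *m col c (cokermx B) = 0.
  by apply: kerBA; rewrite colE mulmxA mulmx_coker mul0mx.
by rewrite colE mulmxA -colE => /matrixP/(_ i 0); rewrite !mxE.
Qed.

End Dot.

(** * The strict S-lemma *)

Section SLemma.
Set Implicit Arguments.
Unset Strict Implicit.
Context {R : realType}.
Import numFieldNormedType.Exports.

Lemma continuous_rV_sum d I (r : seq I) (f : I -> 'rV[R]_d -> R) :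
  (forall i, continuous (f i)) -> continuous (fun v => \sum_(i <- r) f i v).
Proof.
move=> fC; elim: r => [|i r IH].
  have -> : (fun v => \sum_(i <- [::]) f i v) = (fun=> 0).
    by apply/funext => v; rewrite big_nil.
  exact: cst_continuous.
have -> : (fun v => \sum_(j <- i :: r) f j v) =
    (fun v => f i v + \sum_(j <- r) f j v).
  by apply/funext => v; rewrite big_cons.
by move=> v; apply: continuousD; [exact: fC | exact: IH].
Qed.

Lemma continuous_rV_mul d (f g : 'rV[R]_d -> R) :
  continuous f -> continuous g -> continuous (fun v => f v * g v).
Proof. by move=> fC gC v; apply: continuousM; [exact: fC | exact: gC]. Qed.

Lemma quad_continuous d (M : 'M[R]_d) :
  continuous (fun v : 'rV[R]_d => dot v^T (M *m v^T)).
Proof.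
have -> : (fun v : 'rV[R]_d => dot v^T (M *m v^T)) =
    (fun v => \sum_i \sum_j v 0 i * (M i j * v 0 j)).
  apply: funext => v; rewrite dotE; apply: eq_bigr => i _.
  by rewrite !mxE mulr_sumr; apply: eq_bigr => j _; rewrite mxE.
apply: continuous_rV_sum => i; apply: continuous_rV_sum => j.
apply: continuous_rV_mul; first exact: coord_continuous.
apply: continuous_rV_mul; [exact: cst_continuous | exact: coord_continuous].
Qed.

(** By homogeneity it suffices to treat unit vectors; the admissible ones form a compact set, and
    the minimum of the form of [M] there serves as [eps]. *)
Lemma quad_cone_min d k (M N : 'M[R]_d) (Om : 'M[R]_(k, d)) :
  (forall x : 'cV_d, Om *m x = 0 -> x != 0 -> 0 <= dot x (N *m x) ->
     0 < dot x (M *m x)) ->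
  exists2 eps, 0 < eps & forall x : 'cV_d, Om *m x = 0 -> 0 <= dot x (N *m x) ->
     eps * dot x x <= dot x (M *m x).
Proof.
move=> MN.
pose q A (v : 'rV[R]_d) := dot v^T (A *m v^T).
(* Writing [Om *m x = 0] as the vanishing of the form of [Om^T *m Om] makes all three conditions
   closed by continuity of quadratic forms. *)
pose S := ([set v | q (Om^T *m Om) v = 0] `&` [set v | q 1%:M v = 1]
           `&` [set v | 0 <= q N v])%classic.
have qZ A c (v : 'rV[R]_d) : q A (c *: v) = c ^+ 2 * q A v.
  by rewrite /q linearZ /= -scalemxAr dotZl dotZr mulrA expr2.
have qOm v : q (Om^T *m Om) v = dot (Om *m v^T) (Om *m v^T).
  by rewrite dot_mulmx mulmxA.
have q1 v : q 1%:M v = dot v^T v^T by rewrite /q mul1mx.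
have SP v : S v <-> [/\ Om *m v^T = 0, dot v^T v^T = 1 & 0 <= q N v].
  rewrite /S /= qOm q1; split=> [[[]]|[Ov v1 Nv]].
    by move=> /dot_eq0.
  by rewrite Ov dot0l.
have Snorm x : Om *m x = 0 -> 0 <= dot x (N *m x) -> x != 0 ->
    S ((Num.sqrt (dot x x))^-1 *: x^T).
  move=> Ox Nx x0; apply/SP.
  rewrite qZ /q linearZ /= trmxK -scalemxAr Ox scaler0 dotZl dotZr mulrA -expr2.
  rewrite exprVn sqr_sqrtr ?dot_ge0 // mulVf ?gt_eqF ?dot_gt0 //; split=> //.
  by rewrite mulr_ge0 // invr_ge0 dot_ge0.
have qclosed A (D : set R) : closed D -> closed (q A @^-1` D)%classic.
  by move=> Dc; apply: preimage_closed Dc => v _; exact: quad_continuous.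
have cube_compact : compact [set v : 'rV[R]_d | forall i, v ord0 i \in `[(-1), 1]].
  apply: (@rV_compact _ _ (fun=> `[(-1 : R), 1]%classic)).
  by move=> _; exact: segment_compact.
have Scompact : compact S.
  apply: subclosed_compact cube_compact _.
    apply: closedI; first apply: closedI.
    - exact: (qclosed _ _ (@closed_eq R 0)).
    - exact: (qclosed _ _ (@closed_eq R 1)).
    - exact: (qclosed _ _ (@closed_ge R 0)).
  move=> v /SP[_ v1 _] i; rewrite in_itv /= -ler_norml -(@expr_le1 _ 2) //.
  rewrite real_normK ?num_real // -v1 dotE (bigD1 i) //= !mxE expr2 lerDl.
  by apply: sumr_ge0 => j _; rewrite !mxE -expr2 sqr_ge0.
(* If [S] is empty, only [x = 0] is admissible and any positive constant works. *)
have [[v0 Sv0]|S0] := pselect (exists v, S v); last first.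
  exists 1 => // x Ox Nx; have [->|x0] := eqVneq x 0; first by rewrite !dot0l mulr0.
  by case: S0; eexists; exact: (Snorm x Ox Nx x0).
have qC : {within S, continuous (q M)}%classic.
  by apply: continuous_subspaceT => v; exact: quad_continuous.
have [c cS cmin] := compact_EVT_min (ex_intro _ v0 Sv0) Scompact qC.
have /SP[Oc c1 Nc] := set_mem cS.
exists (q M c) => [|x Ox Nx].
  apply: MN => //; apply/eqP => c0; move: c1; rewrite c0 dot0l => /eqP.
  by rewrite eq_sym oner_eq0.
have [->|x0] := eqVneq x 0; first by rewrite !dot0l mulr0.
have := cmin _ (mem_set (Snorm x Ox Nx x0)).
rewrite [leRHS]qZ /q trmxK exprVn sqr_sqrtr ?dot_ge0 //.
by rewrite ler_pdivlMl ?dot_gt0 // mulrC.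
Qed.

(* The two real roots of [a + 2 b t + c t^2] have opposite signs, so a positive
   combination of the values of the second polynomial there has no linear term. *)
Lemma quadratic_S_lemma (a b c A B C : R) : a < 0 -> 0 < c ->
  (forall t, 0 <= a + 2 * b * t + c * t ^+ 2 ->
     0 <= A + 2 * B * t + C * t ^+ 2) -> C * a <= A * c.
Proof.
move=> a0 c0 H; set s := Num.sqrt (b ^+ 2 - a * c).
have disc : b ^+ 2 < b ^+ 2 - a * c by rewrite ltrDl oppr_gt0 nmulr_rlt0.
have s2 : s ^+ 2 = b ^+ 2 - a * c by rewrite sqr_sqrtr // (le_trans (sqr_ge0 b)) ?ltW.
have s0 : 0 < s by rewrite sqrtr_gt0 (le_lt_trans (sqr_ge0 b)).
have /ltr_normlP[bs1 bs2] : `|b| < s.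
  by rewrite -sqrtr_sqr ltr_sqrt // (le_lt_trans (sqr_ge0 b)).
have cn : c != 0 by rewrite gt_eqF.
have H1 := H ((- b + s) / c); have H2 := H ((- b - s) / c).
have E1 : a + 2 * b * ((- b + s) / c) + c * ((- b + s) / c) ^+ 2 = 0.
  have -> : a + 2 * b * ((- b + s) / c) + c * ((- b + s) / c) ^+ 2 =
    (s ^+ 2 - (b ^+ 2 - a * c)) / c by field.
  by rewrite s2 subrr mul0r.
have E2 : a + 2 * b * ((- b - s) / c) + c * ((- b - s) / c) ^+ 2 = 0.
  have -> : a + 2 * b * ((- b - s) / c) + c * ((- b - s) / c) ^+ 2 =
    (s ^+ 2 - (b ^+ 2 - a * c)) / c by field.
  by rewrite s2 subrr mul0r.
rewrite E1 in H1; rewrite E2 in H2; move/(_ (lexx _)): H1 => H1.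
move/(_ (lexx _)): H2 => H2.
have sb1 : 0 < s + b by lra.
have sb2 : 0 < s - b by lra.
have := addr_ge0 (mulr_ge0 (ltW sb1) H1) (mulr_ge0 (ltW sb2) H2).
have -> : (s + b) * (A + 2 * B * ((- b + s) / c) + C * ((- b + s) / c) ^+ 2) +
    (s - b) * (A + 2 * B * ((- b - s) / c) + C * ((- b - s) / c) ^+ 2) =
    2 * s / c * (A * c + C * (s ^+ 2 - b ^+ 2) / c) by field.
have -> : C * (s ^+ 2 - b ^+ 2) / c = - (C * a) by rewrite s2; field.
by rewrite pmulr_rge0 ?subr_ge0 // divr_gt0 // mulr_gt0.
Qed.

(** Subtracting [eps * dot x x] leaves a form [f] that is nonnegative wherever that of [N] is. Then
    [alpha] has to separate the ratios [f u / nq u] with [nq u < 0] from the ratios [f v / nq v]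
    with [nq v > 0]. *)
Lemma strict_S_lemma d k (M N : 'M[R]_d) (Om : 'M[R]_(k, d)) :
  sym_mx M -> sym_mx N ->
  (forall x : 'cV_d, Om *m x = 0 -> x != 0 -> 0 <= dot x (N *m x) ->
     0 < dot x (M *m x)) ->
  (exists2 x : 'cV_d, Om *m x = 0 & 0 < dot x (N *m x)) ->
  exists alpha eps, [/\ 0 <= alpha, 0 < eps &
    forall x : 'cV_d, Om *m x = 0 ->
      alpha * dot x (N *m x) + eps * dot x x <= dot x (M *m x)].
Proof.
move=> Ms Ns MN [x0 Ox0 Nx0]; have [eps eps0 Meps] := quad_cone_min MN.
pose nq (x : 'cV[R]_d) := dot x (N *m x).
pose f (x : 'cV[R]_d) := dot x (M *m x) - eps * dot x x.
have f_ge0 x : Om *m x = 0 -> 0 <= nq x -> 0 <= f x.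
  by move=> Ox Nx; rewrite subr_ge0; exact: Meps.
have cross u v : Om *m u = 0 -> Om *m v = 0 -> nq u < 0 -> 0 < nq v ->
    f v * nq u <= f u * nq v.
  move=> Ou Ov Nu Nv.
  (* On the line [u + t *: v] both forms are quadratic polynomials in [t], with the signs that the
     scalar lemma requires. *)
  apply: (@quadratic_S_lemma _ (dot u (N *m v)) _ _
    (dot u (M *m v) - eps * dot u v) _ Nu Nv) => t.
  have Ouv : Om *m (u + t *: v) = 0 by rewrite mulmxDr -scalemxAr Ou Ov scaler0 addr0.
  have := f_ge0 _ Ouv.
  have -> : nq (u + t *: v) = nq u + 2 * dot u (N *m v) * t + nq v * t ^+ 2.
    rewrite /nq mulmxDr -scalemxAr !dot_lin (dot_sym_mx v u Ns); ring.
  have -> : f (u + t *: v) = f u + 2 * (dot u (M *m v) - eps * dot u v) * t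
      + f v * t ^+ 2.
    rewrite /f mulmxDr -scalemxAr !dot_lin (dot_sym_mx v u Ms) (dotC v u); ring.
  exact.
pose E := [set r | exists v, [/\ Om *m v = 0, 0 < nq v & r = f v / nq v]]%classic.
have E0 : (E !=set0)%classic by exists (f x0 / nq x0), x0.
have lbE u : Om *m u = 0 -> nq u < 0 -> lbound E (f u / nq u).
  move=> Ou Nu _ [v [Ov Nv ->]].
  by rewrite ler_ndivrMr // mulrAC ler_pdivrMr // cross.
have lbE0 : lbound E 0.
  by move=> _ [v [Ov Nv ->]]; rewrite divr_ge0 ?f_ge0 ?ltW.
(* [E] is nonempty by the Slater point [x0]; its lower bound 0 gives [0 <= alpha], and [lbE] settles
   the vectors with [nq x < 0]. *)
exists (inf E), eps; split=> //; first exact: lb_le_inf.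
move=> x Ox; rewrite -lerBrDr -/(nq x) -/(f x).
have [Nx|Nx|Nx] := ltgtP (nq x) 0.
- by rewrite -ler_ndivrMr //; apply: lb_le_inf => //; exact: lbE.
- rewrite -ler_pdivlMr //; apply: ge_inf; first by exists 0.
  by exists x.
- by rewrite Nx mulr0 f_ge0 // Nx.
Qed.

End SLemma.

(** * Lyapunov inequalities *)

Section Lyapunov.
Set Implicit Arguments.
Unset Strict Implicit.
Context {R : realType}.

Lemma dot_delta n (M : 'M[R]_n) i :
  dot (delta_mx i 0 : 'cV_n) (M *m delta_mx i 0) = M i i.
Proof. by rewrite /dot trmx_delta -colE -rowE !mxE. Qed.

Lemma eigenvalue_trmx (F : fieldType) n (A : 'M[F]_n) a :
  eigenvalue A^T a = eigenvalue A a.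
Proof.
rewrite /eigenvalue /eigenspace !kermx_eq0 /row_free -mxrank_tr.
by rewrite linearB /= trmxK tr_scalar_mx.
Qed.

(** For a complex eigenvector [x + i y], applying [A] multiplies the sum of the forms of [P] at [x]
    and [y] by the squared modulus of [lambda]; strict decrease makes this factor less than 1. *)
Lemma lyapunov_schur_stable n (P A : 'M[R]_n) :
  posdef P ->
  (forall x : 'cV_n, x != 0 -> dot (A *m x) (P *m (A *m x)) < dot x (P *m x)) ->
  schur_stable A.
Proof.
(* Eigenvectors are row vectors, so passing to [A^T] yields a right eigenvector of [A]. *)
move=> Pp decr lambda; rewrite -eigenvalue_trmx => /eigenvalueP[v vA v0].
have [Ps _] := Pp.
pose x : 'cV[R]_n := \col_i complex.Re (v 0 i).
pose y : 'cV[R]_n := \col_i complex.Im (v 0 i).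
have vAE i : \sum_j v 0 j * ((A i j)%:C)%C = lambda * v 0 i.
  move: vA => /matrixP/(_ 0 i); rewrite !mxE => <-.
  by apply: eq_bigr => j _; rewrite !mxE.
have Ax : A *m x = complex.Re lambda *: x - complex.Im lambda *: y.
  apply/matrixP => i j; rewrite !mxE.
  have := congr1 (@complex.Re R) (vAE i); rewrite raddf_sum => E.
  transitivity (complex.Re (lambda * v 0 i)); last by case: (lambda) (v 0 i) => [? ?] [? ?].
  rewrite -E; apply: eq_bigr => k _; rewrite !mxE.
  by case: (v 0 k) => a b /=; ring.
have Ay : A *m y = complex.Im lambda *: x + complex.Re lambda *: y.
  apply/matrixP => i j; rewrite !mxE.
  have := congr1 (@complex.Im R) (vAE i); rewrite raddf_sum => E.
  transitivity (complex.Im (lambda * v 0 i)).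
    rewrite -E; apply: eq_bigr => k _; rewrite !mxE.
    by case: (v 0 k) => a b /=; ring.
  by case: (lambda) (v 0 i) => [? ?] [? ?] /=; ring.
have xy0 : (x != 0) || (y != 0).
  rewrite -negb_and; apply: contra v0 => /andP[/eqP x0 /eqP y0].
  apply/eqP/matrixP => i j; rewrite ord1 mxE.
  move: x0 y0 => /matrixP/(_ j 0) + /matrixP/(_ j 0); rewrite !mxE.
  by case: (v 0 j) => a b /= -> ->.
have le z : dot (A *m z) (P *m (A *m z)) <= dot z (P *m z).
  by have [->|/decr/ltW//] := eqVneq z 0; rewrite mulmx0 mulmx0 dot0l.
have lt : dot (A *m x) (P *m (A *m x)) + dot (A *m y) (P *m (A *m y)) <
    dot x (P *m x) + dot y (P *m y).
  by case/orP: xy0 => /decr z0; [apply: ltr_leD | apply: ler_ltD].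
set r := complex.Re lambda ^+ 2 + complex.Im lambda ^+ 2.
have E : dot (A *m x) (P *m (A *m x)) + dot (A *m y) (P *m (A *m y)) =
    r * (dot x (P *m x) + dot y (P *m y)).
  rewrite Ax Ay !(mulmxDr, mulmxN) -!scalemxAr !dot_lin (dot_sym_mx y x Ps) /r.
  by ring.
have S0 : 0 <= dot x (P *m x) + dot y (P *m y).
  by apply: addr_ge0; apply: posdef_quad_ge0.
have r1 : r < 1.
  rewrite ltNge; apply/negP => r1; move: lt; rewrite E ltNge => /negP; apply.
  by rewrite ler_peMl.
by rewrite normc_def -/r -[1]/(1%:C)%C ltcR -sqrtr1 ltr_sqrt.
Qed.

Lemma mxtrace_gram k n (M : 'M[R]_(k, n)) :
  \tr (M *m M^T) = \sum_i dot (col i M) (col i M).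
Proof.
rewrite mxtrace_mulC; apply: eq_bigr => i _; rewrite dotE mxE.
by apply: eq_bigr => j _; rewrite !mxE.
Qed.

(** With [V k] the trace of [(A^k)^T P A^k], computed column by column, the k-th term is at most
    [V k - V k.+1]. The partial sums telescope below [V 0 = \tr P]; being monotone and bounded, they
    converge. *)
Lemma lyapunov_h2norm n p (P A : 'M[R]_n) (C : 'M[R]_(p, n)) :
  posdef P ->
  (forall x : 'cV_n, dot (A *m x) (P *m (A *m x)) + dot (C *m x) (C *m x)
     <= dot x (P *m x)) ->
  h2norm A C <= Num.sqrt (\tr P).
Proof.
move=> Pp decr.
pose V k := \sum_i dot (col i (A ^+ k)) (P *m col i (A ^+ k)).
have V_ge0 k : 0 <= V k by apply: sumr_ge0 => i _; apply: posdef_quad_ge0.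
have V0 : V 0 = \tr P.
  apply: eq_bigr => i _; rewrite expr0 -(dot_delta P).
  by rewrite (_ : col i 1 = delta_mx i 0) // colE mul1mx.
have h2_ge0 k : 0 <= h2_terms A C k.
  by rewrite /h2_terms mxtrace_gram; apply: sumr_ge0 => i _; apply: dot_ge0.
have stepV k : h2_terms A C k <= V k - V k.+1.
  rewrite /h2_terms mxtrace_gram /V -sumrB; apply: ler_sum => i _.
  rewrite exprS !colE -!mulmxA lerBrDl -!colE; exact: decr.
have sum_le N : series (h2_terms A C) N <= \tr P.
  apply: (@le_trans _ _ (V 0 - V N)); last by rewrite V0 lerBlDr lerDl.
  rewrite /series /=; elim: N => [|N IH]; first by rewrite big_nil subrr.
  by rewrite big_nat_recr //= (le_trans (lerD IH (stepV N))) // subrKA.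
apply: ler_wsqrtr; apply: limr_le; last by apply: nearW.
apply: nondecreasing_is_cvgn.
  by apply: nondecreasing_series => k _ _.
by exists (\tr P) => _ [N _ <-].
Qed.

End Lyapunov.

(** * Extending a vector to a consistent system *)

Section MatrixExtension.
Set Implicit Arguments.
Unset Strict Implicit.
Context {R : realType}.

Lemma sym_congr j k (M : 'M[R]_j) (B : 'M[R]_(j, k)) :
  sym_mx M -> sym_mx (B^T *m M *m B).
Proof. by move=> Ms; rewrite /sym_mx !trmx_mul trmxK Ms mulmxA. Qed.

Lemma dot_congr j k (M : 'M[R]_j) (B : 'M[R]_(j, k)) (x : 'cV_k) :
  dot x (B^T *m M *m B *m x) = dot (B *m x) (M *m (B *m x)).
Proof. by rewrite dot_mulmx -!mulmxA. Qed.

Lemma col_mx1_mul n l (Z : 'M[R]_(l, n)) (a : 'cV_n) :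
  col_mx 1%:M Z *m a = col_mx a (Z *m a).
Proof. by rewrite mul_col_mx mul1mx. Qed.

Lemma posdef_cauchy_schwarz k (M : 'M[R]_k) (x y : 'cV_k) :
  posdef M -> y != 0 ->
  dot x (M *m y) ^+ 2 / dot y (M *m y) <= dot x (M *m x).
Proof.
move=> Mp y0; have [Ms _] := Mp; have /posdefP[_ /(_ y y0) My] := Mp.
set s := dot x _; set t := s / dot y (M *m y).
have := posdef_quad_ge0 (x - t *: y) Mp.
rewrite mulmxDr mulmxN -scalemxAr !dot_lin (dot_sym_mx y x Ms) -/s.
have -> : dot x (M *m x) - t * s + (- (t * s) - t * - (t * dot y (M *m y))) =
    dot x (M *m x) - s ^+ 2 / dot y (M *m y).
  by rewrite /t; field; rewrite gt_eqF.
by rewrite subr_ge0.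
Qed.

(* With [Zc] the center of the set, [N22 Zc = - N21], the form at [(a, Zc a + r)] is
   [a^T Delta a + r^T N22 r], and the rank one update
   [Z = Zc + (r - Zc q) (Delta q)^T / (q^T Delta q)] is admissible by Cauchy-Schwarz. *)
Lemma psd_graph_extension n l (N : 'M[R]_(n + l)) (Zbar : 'M[R]_(l, n))
    (q : 'cV_n) (r : 'cV_l) :
  sym_mx N ->
  (forall s : 'cV_l, dot (col_mx 0 s) (N *m col_mx 0 s) <= 0) ->
  (forall s : 'cV_l, dot (col_mx 0 s) (N *m col_mx 0 s) = 0 ->
     N *m col_mx (0 : 'cV_n) s = 0) ->
  posdef ((col_mx 1%:M Zbar)^T *m N *m col_mx 1%:M Zbar) ->
  q != 0 -> 0 <= dot (col_mx q r) (N *m col_mx q r) ->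
  exists2 Z : 'M[R]_(l, n), Z *m q = r
    & psd ((col_mx 1%:M Z)^T *m N *m col_mx 1%:M Z).
Proof.
move=> Ns N22_le0 N22_ker Slater q0 qr_ge0.
set N11 := ulsubmx N; set N12 := ursubmx N; set N22 := drsubmx N.
have N21E : dlsubmx N = N12^T by rewrite /N12 trmx_ursub Ns.
have N11s : sym_mx N11 by rewrite /sym_mx /N11 trmx_ulsub Ns.
have N22s : sym_mx N22 by rewrite /sym_mx /N22 trmx_drsub Ns.
have NE a b : N *m col_mx a b =
    col_mx (N11 *m a + N12 *m b) (N12^T *m a + N22 *m b) :> 'cV_(n + l).
  by rewrite -{1}[N]submxK N21E mul_block_col.
(* This makes the equation [N22 *m Zc = - N12^T] of the center solvable: a kernel vector of [N22]
   annihilates the form, so [N22_ker] puts it in the kernel of [N12]. *)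
have /submxP[W N12E] : (N12 <= N22)%MS.
  apply: submx_ker => s N22s0.
  have := N22_ker s; rewrite NE N22s0 !mulmx0 !add0r dot_col_mx dot0l dot0r addr0.
  by move=> /(_ erefl); rewrite -col_mx0 => /eq_col_mx[].
pose Zc := - W^T; pose Delta := N11 + N12 *m Zc.
have N22Zc : N22 *m Zc = - N12^T by rewrite mulmxN N12E trmx_mul N22s.
have Deltas : sym_mx Delta.
  rewrite /sym_mx /Delta /Zc linearD /= N11s mulmxN linearN /= N12E.
  by rewrite !trmx_mul trmxK N22s mulmxA.
have formE a s : dot (col_mx a (Zc *m a + s)) (N *m col_mx a (Zc *m a + s)) =
    dot a (Delta *m a) + dot s (N22 *m s).
  have E1 : N11 *m a + N12 *m (Zc *m a + s) = Delta *m a + N12 *m s.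
    by rewrite mulmxDr addrA mulmxA -mulmxDl.
  have E2 : N12^T *m a + N22 *m (Zc *m a + s) = N22 *m s.
    by rewrite mulmxDr mulmxA N22Zc mulNmx addrA subrr add0r.
  have E3 : dot (Zc *m a) (N22 *m s) = - dot a (N12 *m s).
    rewrite dot_mulmx mulmxA -[X in _^T *m X]N22s -trmx_mul N22Zc.
    by rewrite linearN /= trmxK mulNmx dotNr.
  by rewrite NE dot_col_mx E1 E2 !dot_lin E3; ring.
have N22_npos s : dot s (N22 *m s) <= 0.
  have := N22_le0 s; rewrite NE !mulmx0 !add0r dot_col_mx dot0l add0r.
  exact.
(* The Slater form at [Zbar] is that of [Delta] plus a nonpositive [N22] term. *)
have Deltap : posdef Delta.
  apply/posdefP; split=> // a a0; have /posdefP[_ /(_ a a0)] := Slater.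
  rewrite dot_congr col_mx1_mul -[Zbar *m a](addrNK (Zc *m a)) addrC formE.
  by move=> /lt_le_trans; apply; rewrite gerDl.
set rho := r - Zc *m q; set mu := dot q (Delta *m q).
have mu0 : 0 < mu by have /posdefP[_ /(_ q q0)] := Deltap.
have mun : mu != 0 by rewrite gt_eqF.
have rhoN : - mu <= dot rho (N22 *m rho).
  by rewrite -subr_ge0 opprK addrC -formE /rho addrC subrK.
pose Z := Zc + mu^-1 *: (rho *m (Delta *m q)^T).
have ZE a : Z *m a = Zc *m a + (dot (Delta *m q) a / mu) *: rho.
  rewrite /Z mulmxDl -scalemxAl -mulmxA [_^T *m a]mx11_scalar mul_mx_scalar.
  by rewrite scalerA mulrC.
exists Z; first by rewrite ZE dotC -/mu divff // scale1r /rho addrC subrK.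
apply/psdP; split; first exact: sym_congr.
move=> a; rewrite dot_congr col_mx1_mul ZE formE -scalemxAr dotZl dotZr mulrA -expr2.
have := posdef_cauchy_schwarz a Deltap q0; rewrite -/mu -(dotC (Delta *m q)).
set u := dot _ a => CS.
have : (u / mu) ^+ 2 * (- mu) <= (u / mu) ^+ 2 * dot rho (N22 *m rho).
  by rewrite ler_wpM2l ?sqr_ge0.
have -> : (u / mu) ^+ 2 * - mu = - (u ^+ 2 / mu) by field.
lra.
Qed.

End MatrixExtension.

(** * Consistent systems as solutions of a quadratic matrix inequality *)

Section Data.
Set Implicit Arguments.
Unset Strict Implicit.
Context {R : realType} {n m T : nat}.
Variables (Phi11 : 'M[R]_n) (Phi12 : 'M[R]_(n, T)) (Phi22 : 'M[R]_T).
Variables (Xp Xm : 'M[R]_(n, T)) (Um : 'M[R]_(m, T)).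
Hypotheses (hPhi11 : sym_mx Phi11) (hPhi22 : negdef Phi22).

Local Notation Phi := (Phi_mx Phi11 Phi12 Phi22).
Local Notation N := (Nmx Phi11 Phi12 Phi22 Xp Xm Um).
Local Notation data := (data_mx Xp Xm Um).
Local Notation inSigma := (Sigma Phi11 Phi12 Phi22 Xp Xm Um).

Lemma data_mxT_col k (q : 'M[R]_(n, k)) (r : 'M[R]_(n + m, k)) :
  data^T *m col_mx q r = col_mx q (Xp^T *m q - (col_mx Xm Um)^T *m r).
Proof.
rewrite /data_mx -[r]vsubmxK !tr_col_mx !tr_row_mx !mul_row_col !mul_col_mx.
rewrite !linear0 !linearN /= trmx1 mul1mx !mul0mx !mulNmx.
by rewrite !add_col_mx !addr0 opprD.
Qed.

Lemma data_mxT_graph (A : 'M[R]_n) (B : 'M[R]_(n, m)) :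
  data^T *m col_mx 1%:M (col_mx A^T B^T) =
  col_mx 1%:M (Xp - A *m Xm - B *m Um)^T.
Proof.
rewrite data_mxT_col mulmx1 tr_col_mx mul_row_col -!trmx_mul.
by rewrite !linearB /= opprD addrA.
Qed.

Lemma SigmaP (A : 'M[R]_n) (B : 'M[R]_(n, m)) :
  inSigma A B <-> noise_ok Phi11 Phi12 Phi22 (Xp - A *m Xm - B *m Um).
Proof.
split=> [[W [XpE Wok]]|Wok]; last first.
  by exists (Xp - A *m Xm - B *m Um); split=> //;
    rewrite -(addrA Xp) -opprD addrCA subrr addr0.
by rewrite -(addrA Xp) -opprD XpE (addrC _ W) addrK.
Qed.

(** [data^T] maps the graph of [Z] to the graph of the transposed residual, so the noise inequality
    for the residual is the inequality of [N] at [Z]. *)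
Lemma Sigma_graphP (A : 'M[R]_n) (B : 'M[R]_(n, m)) (Z := col_mx A^T B^T) :
  inSigma A B <-> psd ((col_mx 1%:M Z)^T *m N *m col_mx 1%:M Z).
Proof.
rewrite SigmaP /noise_ok -data_mxT_graph /Nmx !trmx_mul trmxK.
by rewrite !mulmxA.
Qed.

Lemma sym_Phi_mx : sym_mx Phi.
Proof.
have Phi22s : Phi22^T = Phi22.
  by case: hPhi22 => + _; rewrite /sym_mx linearN /= => /oppr_inj.
by rewrite /sym_mx /Phi_mx tr_block_mx hPhi11 Phi22s trmxK.
Qed.

Lemma sym_Nmx : sym_mx N.
Proof. by rewrite /Nmx -{1}[data]trmxK; apply: sym_congr; exact: sym_Phi_mx. Qed.

Lemma Nmx_form z :
  dot z (N *m z) = dot (data^T *m z) (Phi *m (data^T *m z)).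
Proof. by rewrite dot_mulmx trmxK /Nmx !mulmxA. Qed.

Lemma Phi_form0 (w : 'cV[R]_T) :
  dot (col_mx 0 w) (Phi *m col_mx 0 w) = dot w (Phi22 *m w).
Proof. by rewrite /Phi_mx mul_block_col !mulmx0 !add0r dot_col_mx dot0l add0r. Qed.

Lemma Phi22_lt0 (w : 'cV[R]_T) : w != 0 -> dot w (Phi22 *m w) < 0.
Proof.
have /posdefP[_ H] := hPhi22.
by move=> /H; rewrite mulNmx dotNr oppr_gt0.
Qed.

(** [data^T] sends [(0, s)] into the noise block, where the form is that of [Phi22 < 0]; this gives
    both the sign and the kernel condition of [psd_graph_extension]. *)
Lemma Sigma_extension Zbar (q : 'cV[R]_n) (r : 'cV[R]_(n + m)) :
  posdef ((col_mx 1%:M Zbar)^T *m N *m col_mx 1%:M Zbar) ->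
  q != 0 -> 0 <= dot (col_mx q r) (N *m col_mx q r) ->
  exists A B, inSigma A B /\ col_mx A^T B^T *m q = r.
Proof.
move=> Slater q0 qr.
have data0 s : data^T *m col_mx (0 : 'cV_n) s =
    col_mx 0 (- ((col_mx Xm Um)^T *m s)).
  by rewrite data_mxT_col mulmx0 add0r.
have [||Z Zq Zpsd] := psd_graph_extension sym_Nmx _ _ Slater q0 qr.
- move=> s; rewrite Nmx_form data0 Phi_form0.
  by have [->|/Phi22_lt0/ltW//] := eqVneq (- ((col_mx Xm Um)^T *m s)) 0; rewrite dot0l.
- move=> s; rewrite Nmx_form data0 Phi_form0.
  have [s0 _|/Phi22_lt0 + s0] := eqVneq (- ((col_mx Xm Um)^T *m s)) 0.
    by rewrite /Nmx -mulmxA data0 s0 col_mx0 mulmx0.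
  by rewrite s0 ltxx.
exists (usubmx Z)^T, (dsubmx Z)^T.
by rewrite Sigma_graphP !trmxK vsubmxK.
Qed.

End Data.

(** * From the LMI to the closed loop *)

Section LMI.
Set Implicit Arguments.
Unset Strict Implicit.
Context {R : realType}.

(** This is the form of [Q] at [x + Q^-1 e], expanded. *)
Lemma complete_square k (Q : 'M[R]_k) (x e : 'cV_k) : posdef Q ->
  0 <= dot x (Q *m x) + 2 * dot e x + dot e (invmx Q *m e).
Proof.
move=> Qp; have [Qs _] := Qp; have Qu := posdef_unitmx Qp.
have := posdef_quad_ge0 (x + invmx Q *m e) Qp.
rewrite mulmxDr mulKVmx // !dot_lin (dot_sym_mx _ x Qs) mulKVmx //.
by rewrite (dotC x e) (dotC _ e); lra.
Qed.

Lemma closed_loop_sym n p (P A : 'M[R]_n) (C : 'M[R]_(p, n)) :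
  sym_mx P -> sym_mx (P - (A^T *m P *m A + C^T *m C)).
Proof.
move=> Ps; have := sym_congr A Ps; rewrite /sym_mx linearB linearD /= Ps => ->.
by rewrite trmx_mul trmxK.
Qed.

Lemma closed_loop_form n p (P A : 'M[R]_n) (C : 'M[R]_(p, n)) (x : 'cV_n) :
  dot x ((P - (A^T *m P *m A + C^T *m C)) *m x) =
  dot x (P *m x) - (dot (A *m x) (P *m (A *m x)) + dot (C *m x) (C *m x)).
Proof.
by rewrite mulmxBl mulmxDl !dot_lin dot_congr (dot_mulmx C) (mulmxA _ C).
Qed.

Lemma block_form j k (Z : 'M[R]_j) (B : 'M[R]_(k, j)) (Y : 'M[R]_k)
    (a : 'cV_j) (b : 'cV_k) :
  dot (col_mx a b) (block_mx Z B^T B Y *m col_mx a b) =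
  dot a (Z *m a) + 2 * dot b (B *m a) + dot b (Y *m b).
Proof.
rewrite mul_block_col dot_col_mx !dot_lin -(dot_mulmx B) (dotC _ b).
by ring.
Qed.

(** Testing on [(e_i, - Y^-1 e_i)] bounds each diagonal entry of [Y^-1] by that of [Z]. *)
Lemma psd_block_trace n (Z Y : 'M[R]_n) :
  posdef Y -> psd (block_mx Z 1%:M 1%:M Y) -> \tr (invmx Y) <= \tr Z.
Proof.
move=> Yp /psdP[_ ZY]; have Yu := posdef_unitmx Yp.
apply: ler_sum => i _; rewrite -!dot_delta; set e := delta_mx _ _.
have := ZY (col_mx e (- (invmx Y *m e))).
rewrite -{1}[1%:M]trmx1 block_form mul1mx mulmxN mulKVmx // !dot_lin.
by rewrite (dotC _ e); lra.
Qed.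

Section Problem.
Context {n m p T : nat}.
Variables (Phi11 : 'M[R]_n) (Phi12 : 'M[R]_(n, T)) (Phi22 : 'M[R]_T).
Variables (Xp Xm : 'M[R]_(n, T)) (Um : 'M[R]_(m, T)).
Variables (C : 'M[R]_(p, n)) (D : 'M[R]_(p, m)).
Hypotheses (hPhi11 : sym_mx Phi11) (hPhi22 : negdef Phi22).

Local Notation Phi := (Phi_mx Phi11 Phi12 Phi22).
Local Notation N := (Nmx Phi11 Phi12 Phi22 Xp Xm Um).
Local Notation data := (data_mx Xp Xm Um).
Local Notation data5 := (data_mx5 p Xp Xm Um).
Local Notation inSigma := (Sigma Phi11 Phi12 Phi22 Xp Xm Um).

(** Turns the five-block inequality into a scalar one for both directions of the proof; [r] keeps
    the state and input blocks together. *)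
Lemma lmi_form Y L beta alpha (q : 'cV[R]_n) (r : 'cV[R]_(n + m))
    (s : 'cV[R]_n) (t : 'cV[R]_p) (X := col_mx (col_mx q r) (col_mx s t)) :
  dot X ((lmi_mx C D Y L beta - alpha *: (data5 *m Phi *m data5^T)) *m X) =
  dot q (Y *m q) - beta * dot q q + 2 * dot r (col_mx Y L *m s)
  + dot s (Y *m s) + 2 * dot t ((C *m Y + D *m L) *m s) + dot t t
  - alpha * dot (col_mx q r) (N *m col_mx q r).
Proof.
have d5 : data5^T *m X = data^T *m col_mx q r.
  by rewrite /data_mx5 tr_col_mx mul_row_col trmx0 mul0mx addr0.
rewrite mulmxBl dotDr dotNr -scalemxAl dotZr; congr (_ - alpha * _).
  rewrite /lmi_mx /X.
  set UR := col_mx 0 (row_mx _ 0).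
  have URE : dot (col_mx s t) (UR^T *m col_mx q r) = dot r (col_mx Y L *m s).
    rewrite dotC dot_mulmx trmxK /UR mul_col_mx mul0mx mul_row_col mul0mx addr0.
    by rewrite dot_col_mx dot0r add0r.
  have Y0 : dot (col_mx q r) (block_mx (Y - beta%:M) 0 0 0 *m col_mx q r) =
      dot q (Y *m q) - beta * dot q q.
    rewrite mul_block_col !mul0mx !addr0 dot_col_mx dot0r addr0.
    by rewrite mulmxBl mul_scalar_mx !dot_lin.
  rewrite -{1}[UR]trmxK block_form Y0 URE block_form mul1mx.
  by rewrite !addrA.
by rewrite Nmx_form -d5 (dot_mulmx data5^T) trmxK !mulmxA.
Qed.

Lemma sym_lmi Y L beta alpha : sym_mx Y ->
  sym_mx (lmi_mx C D Y L beta - alpha *: (data5 *m Phi *m data5^T)).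
Proof.
move=> Ys; have := sym_congr data5^T (sym_Phi_mx Phi12 hPhi11 hPhi22).
rewrite /sym_mx trmxK linearB /= linearZ /= => ->; congr (_ - _).
by rewrite /lmi_mx !tr_block_mx !trmx0 !trmxK linearB /= tr_scalar_mx trmx1 Ys.
Qed.

Lemma lmi_closed_loop Y L alpha beta A B (K := L *m invmx Y) (P := invmx Y) :
  posdef Y -> 0 <= alpha -> 0 < beta ->
  psd (lmi_mx C D Y L beta - alpha *: (data5 *m Phi *m data5^T)) ->
  posdef (block_mx Y (C *m Y + D *m L)^T (C *m Y + D *m L) 1%:M) ->
  inSigma A B ->
  posdef (P - ((A + B *m K)^T *m P *m (A + B *m K)
               + (C + D *m K)^T *m (C + D *m K))).
Proof.
move=> Yp alpha0 beta0 /psdP[_ lmi] /posdefP[_ blk].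
move=> /Sigma_graphP /psdP[_ AB].
have Yu := posdef_unitmx Yp; have Pp : posdef P := posdef_invmx Yp.
have [Ps _] := Pp.
apply/posdefP; split; first exact: closed_loop_sym.
move=> x x0; rewrite closed_loop_form.
set v := (A + B *m K) *m x; set z := (C + D *m K) *m x.
pose s := P *m x; pose q := P *m v.
have Ysx : Y *m s = x by rewrite /s mulKVmx.
have Lsx : L *m s = K *m x by rewrite /s mulmxA.
clearbody K.
have zE : (C *m Y + D *m L) *m s = z.
  by rewrite mulmxDl -!mulmxA Ysx Lsx /z mulmxDl mulmxA.
have s0 : s != 0 by apply: contra_neq x0 => s0; rewrite -Ysx s0 mulmx0.
pose r : 'cV[R]_(n + m) := col_mx A^T B^T *m q.
have rE : dot r (col_mx Y L *m s) = dot q v.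
  rewrite /r !mul_col_mx dot_col_mx (dot_mulmx A^T) (dot_mulmx B^T) !trmxK Ysx Lsx -dotDr.
  by rewrite /v mulmxDl mulmxA.
have N_ge0 : 0 <= dot (col_mx q r) (N *m col_mx q r).
  by have := AB q; rewrite dot_congr col_mx1_mul.
have := lmi (col_mx (col_mx q r) (col_mx (- s) z)).
rewrite lmi_form !mulmxN zE !dotNr !dotNl rE Ysx.
rewrite (_ : Y *m q = v); last by rewrite /q mulKVmx.
rewrite (dotC v) (dotC x (P *m x)) -/s -/q => ineq.
have := mulr_ge0 alpha0 N_ge0.
(* Strictness comes from the [beta] term when [q != 0], and from the second LMI at [(s, - z)] when
   [q = 0]. *)
have [q0|q0] := eqVneq q 0; last first.
  by have := mulr_gt0 beta0 (dot_gt0 q0); lra.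
have := blk (col_mx s (- z)).
rewrite block_form mulmxN mul1mx zE Ysx !dotNl !dotNr q0 dot0l => blkz.
have /blkz : col_mx s (- z) != 0.
  by apply: contra_neq s0; rewrite -col_mx0 => /eq_col_mx[].
by lra.
Qed.

End Problem.
End LMI.

(** * From informativity to the LMI *)

Section Necessity.
Set Implicit Arguments.
Unset Strict Implicit.
Context {R : realType} {n m p T : nat}.
Variables (Phi11 : 'M[R]_n) (Phi12 : 'M[R]_(n, T)) (Phi22 : 'M[R]_T).
Variables (Xp Xm : 'M[R]_(n, T)) (Um : 'M[R]_(m, T)).
Variables (C : 'M[R]_(p, n)) (D : 'M[R]_(p, m)).
Hypotheses (hPhi11 : sym_mx Phi11) (hPhi22 : negdef Phi22).
Variables (P : 'M[R]_n) (K : 'M[R]_(m, n)).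
Hypothesis Pp : posdef P.

Local Notation Phi := (Phi_mx Phi11 Phi12 Phi22).
Local Notation N := (Nmx Phi11 Phi12 Phi22 Xp Xm Um).
Local Notation data := (data_mx Xp Xm Um).
Local Notation inSigma := (Sigma Phi11 Phi12 Phi22 Xp Xm Um).
Local Notation Y := (invmx P).
Local Notation E := (row_mx (1%:M : 'M[R]_n) K^T).
Local Notation Ccl := (C + D *m K).
Local Notation Q := (P - Ccl^T *m Ccl).

Hypothesis lyap : forall A B, inSigma A B ->
  posdef (P - ((A + B *m K)^T *m P *m (A + B *m K) + Ccl^T *m Ccl)).

Lemma lyap_form A B x : inSigma A B -> x != 0 ->
  dot ((A + B *m K) *m x) (P *m ((A + B *m K) *m x)) + dot (Ccl *m x) (Ccl *m x)
  < dot x (P *m x).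
Proof.
move=> /lyap/posdefP[_ H] /H.
by rewrite closed_loop_form subr_gt0.
Qed.

Lemma Q_form x : dot x (Q *m x) = dot x (P *m x) - dot (Ccl *m x) (Ccl *m x).
Proof. by rewrite mulmxBl dotDr dotNr (dot_mulmx Ccl) mulmxA. Qed.

(** Dropping the positive semidefinite term [(A + B K)^T P (A + B K)] from the Lyapunov inequality
    of a single consistent pair leaves [Q > 0]. *)
Lemma posdef_Q A B : inSigma A B -> posdef Q.
Proof.
move=> AB; have [Ps _] := Pp; apply/posdefP; split.
  by rewrite /sym_mx linearB /= Ps trmx_mul trmxK.
move=> x x0; rewrite Q_form subr_gt0; apply: le_lt_trans (lyap_form AB x0).
by rewrite lerDr posdef_quad_ge0.
Qed.

(* A direction [r] invisible in the data can be added to [(A, B)] with arbitrary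
   size, so boundedness of the closed loop forces [E r = 0]. *)
Lemma unobserved_direction A B (r : 'cV_(n + m)) : inSigma A B ->
  (col_mx Xm Um)^T *m r = 0 -> E *m r = 0.
Proof.
move=> AB; rewrite -[r]vsubmxK tr_col_mx !mul_row_col mul1mx.
set u := usubmx r; set w := dsubmx r => r0.
have [e eE] : exists e, e = u + K^T *m w by exists (u + K^T *m w).
rewrite -eE; apply/eqP/negPn/negP => e0.
(* The rank one change [t *: (e *m r^T)] of [[A B]] annihilates the data, so the residual is
   unchanged. *)
have inS t : inSigma (A + t *: (e *m u^T)) (B + t *: (e *m w^T)).
  have uw : u^T *m Xm + w^T *m Um = 0.
    by apply: trmx_inj; rewrite linearD /= !trmx_mul !trmxK r0 trmx0.
  move: AB; rewrite !SigmaP.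
  rewrite !mulmxDl -!scalemxAl -!mulmxA.
     have -> : w^T *m Um = - (u^T *m Xm) by apply: (addrI (u^T *m Xm)); rewrite uw subrr.
  rewrite mulmxN scalerN !opprD opprK !addrA.
  by rewrite (addrAC _ (- (B *m Um))) subrK.
set g := (A + B *m K) *m e; set c := dot e e.
have c0 : 0 < c by exact: dot_gt0.
have gE t : (A + t *: (e *m u^T) + (B + t *: (e *m w^T)) *m K) *m e =
    g + (t * c) *: e.
  have -> : A + t *: (e *m u^T) + (B + t *: (e *m w^T)) *m K =
      (A + B *m K) + t *: (e *m (u^T + w^T *m K)).
    rewrite mulmxDl mulmxDr scalerDr -scalemxAl mulmxA !addrA; congr (_ + _).
    by rewrite addrAC.
  rewrite mulmxDl -scalemxAl -mulmxA -/g.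
  have -> : (u^T + w^T *m K) *m e = c%:M.
    have -> : u^T + w^T *m K = e^T by rewrite eE linearD /= trmx_mul trmxK.
    exact: mx11_scalar.
  by rewrite mul_mx_scalar scalerA.
(* These two choices of [t] send [e] to [g + e] and [g - e], whose [P]-forms add up to twice those
   of [g] and [e]; they cannot both lie below the [P]-form of [e]. *)
have h1 := lyap_form (inS c^-1) e0; have h2 := lyap_form (inS (- c^-1)) e0.
move: h1 h2; rewrite !gE mulNr mulVf ?gt_eqF // scale1r scaleN1r.
have [Ps _] := Pp; rewrite !mulmxDr mulmxN !dot_lin (dot_sym_mx e g Ps).
have := dot_ge0 (Ccl *m e); have := posdef_quad_ge0 g Pp.
have /posdefP[_ /(_ e e0)] := Pp.
by lra.
Qed.

(* Young's inequality with [x = Q^-1 Acl^T q] and [y = Acl x]: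
   [q^T Acl Q^-1 Acl^T q = y^T q] and [y^T P y < y^T q]. *)
Lemma dual_lyap A B (q : 'cV_n) (e := E *m (col_mx A^T B^T *m q)) :
  inSigma A B -> q != 0 -> dot e (invmx Q *m e) < dot q (Y *m q).
Proof.
move=> AB q0; have Qp := posdef_Q AB; have Qu := posdef_unitmx Qp.
have Pu := posdef_unitmx Pp; have [Ps _] := Pp.
have /posdefP[Ys /(_ q q0) Yq] := posdef_invmx Pp.
have eE : e = (A + B *m K)^T *m q.
  by rewrite /e mulmxA mul_row_col mul1mx -trmx_mul -linearD.
set x := invmx Q *m e.
have Qx : Q *m x = e by rewrite mulKVmx.
have [x0|x0] := eqVneq x 0; first by rewrite x0 dot0r.
have := lyap_form AB x0; set y := _ *m x => lt.
have ex : dot e x = dot y q by rewrite eE (dot_mulmx _^T) trmxK dotC.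
have := Q_form x; rewrite Qx (dotC x e) => Qf.
have := posdef_quad_ge0 (q - P *m y) (posdef_invmx Pp).
rewrite mulmxDr mulmxN mulKmx // !dot_lin (dot_sym_mx _ q Ys) mulKmx //.
rewrite (dotC q y) (dotC _ y) => young.
by rewrite ex in Qf *; lra.
Qed.

(** Both forms vanish along unobserved directions [(0, r)], so the strict S-lemma is applied to
    [v = data^T (q, r)] instead. The range of [data^T] is the kernel of [(cokermx data)^T], which
    plays the part of [Om]. *)
Lemma S_lemma_multipliers A0 B0 Zbar : inSigma A0 B0 ->
  posdef ((col_mx 1%:M Zbar)^T *m N *m col_mx 1%:M Zbar) ->
  exists alpha beta, [/\ 0 <= alpha, 0 < beta &
    forall (q : 'cV_n) (r : 'cV_(n + m)),
      alpha * dot (col_mx q r) (N *m col_mx q r) + beta * dot q q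
      <= dot q (Y *m q) - dot (E *m r) (invmx Q *m (E *m r))].
Proof.
move=> AB0 Slater; have Qp := posdef_Q AB0.
(* For [n = 0] the Slater hypothesis is vacuous and yields no point of positive form; both sides are
   then 0. *)
have [n0|n_gt0] := posnP n.
  have z0 (x : 'cV[R]_n) : x = 0 by apply/matrixP => i; have := ltn_ord i; rewrite {2}n0.
  exists 0, 1; split=> // q r.
  by rewrite (z0 q) (z0 (E *m r)) !dot0l mul0r mulr0 addr0 subrr.
have /submxP[H EH] : (E <= (col_mx Xm Um)^T)%MS.
  by apply: submx_ker => r; exact: unobserved_direction AB0.
(* [F] and [G] recover [q] and [E *m r] from [v]: its second block is [Xp^T q - (col_mx Xm Um)^T r],
   and [E = H *m (col_mx Xm Um)^T]. *)
pose F : 'M[R]_(n, n + T) := row_mx 1%:M 0.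
pose G := row_mx (H *m Xp^T) (- H).
pose M := F^T *m Y *m F - G^T *m invmx Q *m G.
have MP q r : dot (data^T *m col_mx q r) (M *m (data^T *m col_mx q r)) =
    dot q (Y *m q) - dot (E *m r) (invmx Q *m (E *m r)).
  have Gv : G *m (data^T *m col_mx q r) = E *m r.
    rewrite EH data_mxT_col mul_row_col mulNmx mulmxBr opprB !mulmxA.
    by rewrite addrCA subrr addr0.
  have Fv : F *m (data^T *m col_mx q r) = q.
    by rewrite data_mxT_col mul_row_col mul1mx mul0mx addr0.
  by rewrite mulmxBl dotDr dotNr !dot_congr Fv Gv.
have NP z : dot (data^T *m z) (Phi *m (data^T *m z)) = dot z (N *m z).
  by rewrite Nmx_form.
have OmP (v : 'cV[R]_(n + T)) : (cokermx data)^T *m v = 0 ->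
    exists q r, v = data^T *m col_mx q r.
  move=> /(congr1 trmx); rewrite trmx_mul trmxK trmx0 => /eqP.
  rewrite -submxE => /submxP[W vW]; exists (usubmx W^T), (dsubmx W^T).
  by rewrite vsubmxK -trmx_mul -vW trmxK.
have POm (z : 'cV[R]_(n + (n + m))) : (cokermx data)^T *m (data^T *m z) = 0.
  by rewrite mulmxA -trmx_mul mulmx_coker trmx0 mul0mx.
have Ms : sym_mx M.
  have Y1 := sym_congr F (sym_invmx Pp.1).
  have Y2 := sym_congr G (sym_invmx Qp.1).
  by rewrite /sym_mx /M linearB /= Y1 Y2.
have [||alpha [eps [alpha0 eps0 MN]]] :=
    @strict_S_lemma _ _ _ M Phi (cokermx data)^T Ms (sym_Phi_mx Phi12 hPhi11 hPhi22).
- move=> v /OmP[q [r ->]] v0; rewrite NP MP subr_gt0 => N0.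
  (* With [q = 0] the form reduces to that of [Phi22], which is nonnegative only at [v = 0]. *)
  have q0 : q != 0.
    apply: contraNneq v0 => q0; move: N0.
    rewrite q0 Nmx_form data_mxT_col mulmx0 add0r Phi_form0.
    have [->|/(Phi22_lt0 hPhi22) + N0] := eqVneq (- ((col_mx Xm Um)^T *m r)) 0.
      by rewrite col_mx0.
    by rewrite ltNge N0.
  have [A [B [AB Zq]]] := Sigma_extension hPhi11 hPhi22 Slater q0 N0.
  by rewrite -Zq; exact: dual_lyap.
- pose q : 'cV[R]_n := const_mx 1.
  have q0 : q != 0.
    apply/eqP => /matrixP/(_ (Ordinal n_gt0) 0); rewrite !mxE.
    by apply/eqP; rewrite oner_eq0.
  exists (data^T *m col_mx q (Zbar *m q)); first exact: POm.
  rewrite NP; have /posdefP[_ /(_ q q0)] := Slater.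
  by rewrite dot_congr col_mx1_mul.
exists alpha, eps; split=> // q r.
(* Since [q] is the first block of [v], [dot v v] dominates [dot q q], and [eps] serves as
   [beta]. *)
have := MN _ (POm (col_mx q r)); rewrite NP MP.
apply: le_trans; rewrite lerD2l; apply: ler_wpM2l; first exact: ltW.
by rewrite data_mxT_col dot_col_mx lerDl dot_ge0.
Qed.

(** With [x = Y s] and [e = E r], the first form is the gap in the multiplier inequality, plus the
    completed square of [Q] in [x] and [e], plus the squared norm of [Ccl x + t]. The second is the
    form of [Q] at [x] plus that same squared norm. *)
Lemma informative_lmi A0 B0 Zbar (L := K *m Y) : inSigma A0 B0 ->
  posdef ((col_mx 1%:M Zbar)^T *m N *m col_mx 1%:M Zbar) ->
  exists alpha beta, [/\ 0 <= alpha, 0 < beta,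
    psd (lmi_mx C D Y L beta
         - alpha *: (data_mx5 p Xp Xm Um *m Phi *m (data_mx5 p Xp Xm Um)^T)) &
    posdef (block_mx Y (C *m Y + D *m L)^T (C *m Y + D *m L) 1%:M)].
Proof.
move=> AB0 Slater; have Qp := posdef_Q AB0.
have Ps := Pp.1; have Pu := posdef_unitmx Pp; have Yp := posdef_invmx Pp.
have [alpha [beta [alpha0 beta0 mult]]] := S_lemma_multipliers AB0 Slater.
have CL : C *m Y + D *m L = Ccl *m Y by rewrite mulmxDl /L mulmxA.
have formY s : dot s (Y *m s) = dot (Y *m s) (P *m (Y *m s)).
  by rewrite mulKVmx // dotC.
exists alpha, beta; split=> //.
  apply/psdP; split; first exact: sym_lmi Yp.1.
  move=> X; rewrite -[X]vsubmxK -[usubmx X]vsubmxK -[dsubmx X]vsubmxK.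
  move: (usubmx (usubmx X)) (dsubmx (usubmx X)) => q r.
  move: (usubmx (dsubmx X)) (dsubmx (dsubmx X)) => s t.
  rewrite lmi_form CL (formY s) -mulmxA.
  have -> : dot r (col_mx Y L *m s) = dot (E *m r) (Y *m s).
    rewrite dot_mulmx tr_row_mx trmx1 trmxK !mul_col_mx mul1mx.
    by rewrite /L mulmxA.
  set x := Y *m s; have := complete_square x (E *m r) Qp.
  have := mult q r; have := dot_ge0 (Ccl *m x + t); rewrite Q_form !dot_lin.
  by rewrite (dotC (Ccl *m x) t); lra.
apply/posdefP; split.
  by rewrite /sym_mx tr_block_mx trmxK trmx1 Yp.1.
move=> X; rewrite -[X]vsubmxK; move: (usubmx X) (dsubmx X) => s t X0.
rewrite block_form mul1mx CL (formY s) -mulmxA; set x := Y *m s.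
have sx : s = P *m x by rewrite mulKVmx.
have [x0|x0] := eqVneq x 0.
  rewrite x0 !mulmx0 !dot0r mulr0 !add0r; apply: dot_gt0.
  by apply: contraNneq X0 => ->; rewrite sx x0 mulmx0 col_mx0.
have /posdefP[_ /(_ x x0)] := Qp; rewrite Q_form.
have := dot_ge0 (Ccl *m x + t); rewrite !dot_lin (dotC (Ccl *m x) t); lra.
Qed.

End Necessity.

(** * Equivalence of informativity with the LMIs, and the closed-loop guarantee *)

Theorem theorem8 (R : realType) (n m p T : nat)
  (As : 'M[R]_n) (Bs : 'M[R]_(n, m))
  (C : 'M[R]_(p, n)) (D : 'M[R]_(p, m))
  (Xp Xm : 'M[R]_(n, T)) (Um : 'M[R]_(m, T))
  (Phi11 : 'M[R]_n) (Phi12 : 'M[R]_(n, T)) (Phi22 : 'M[R]_T)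
  (hPhi11 : sym_mx Phi11) (hPhi22 : sym_mx Phi22)
  (hPhi22neg : negdef Phi22)
  (hdata : noise_ok Phi11 Phi12 Phi22 (Xp - As *m Xm - Bs *m Um))
  (hZbar : exists Zbar : 'M[R]_(n + m, n),
     posdef ((col_mx 1%:M Zbar)^T *m Nmx Phi11 Phi12 Phi22 Xp Xm Um
               *m col_mx 1%:M Zbar))
  (gamma : R) (hgamma : 0 < gamma) :
  let LMIs := fun (Y Z : 'M[R]_n) (L : 'M[R]_(m, n)) (alpha beta : R) =>
    [/\ sym_mx Y, posdef Y, sym_mx Z, 0 <= alpha & 0 < beta] /\
    [/\ psd (lmi_mx C D Y L beta
             - alpha *: (data_mx5 p Xp Xm Um *m Phi_mx Phi11 Phi12 Phi22
                          *m (data_mx5 p Xp Xm Um)^T)),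
        posdef (block_mx Y (C *m Y + D *m L)^T (C *m Y + D *m L) 1%:M),
        psd (block_mx Z 1%:M 1%:M Y)
      & \tr Z < gamma ^+ 2] in
  (informative_H2 Phi11 Phi12 Phi22 Xp Xm Um C D gamma <->
     exists Y Z L alpha beta, LMIs Y Z L alpha beta) /\
  (forall Y Z L alpha beta, LMIs Y Z L alpha beta ->
     let K := L *m invmx Y in
     forall A B, Sigma Phi11 Phi12 Phi22 Xp Xm Um A B ->
       schur_stable (A + B *m K) /\ h2norm (A + B *m K) (C + D *m K) < gamma).
Proof.
(* The true system is consistent, so [Sigma] is nonempty, as the necessity part requires. *)
have hAB : Sigma Phi11 Phi12 Phi22 Xp Xm Um As Bs by apply/SigmaP.
move=> LMIs.
have closed_loop Y Z L alpha beta A B (K := L *m invmx Y) : LMIs Y Z L alpha beta ->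
    Sigma Phi11 Phi12 Phi22 Xp Xm Um A B ->
    posdef (invmx Y - ((A + B *m K)^T *m invmx Y *m (A + B *m K)
                       + (C + D *m K)^T *m (C + D *m K))).
  move=> [[_ Yp _ alpha0 beta0] [lmi blk _ _]].
  exact: lmi_closed_loop Yp alpha0 beta0 lmi blk.
have trace_lt Y Z L alpha beta : LMIs Y Z L alpha beta -> \tr (invmx Y) < gamma ^+ 2.
  move=> [[_ Yp _ _ _] [_ _ ZY trZ]].
  exact: le_lt_trans (psd_block_trace Yp ZY) trZ.
split; first split.
- move=> [P [K [Pp [lyap trP]]]]; have [Zbar Slater] := hZbar.
  have [alpha [beta [alpha0 beta0 lmi blk]]] :=
    informative_lmi hPhi11 hPhi22neg Pp lyap hAB Slater.
  have Yp := posdef_invmx Pp.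
  (* [Z = P = Y^-1] attains equality in the trace bound, so the trace condition carries over
     unchanged. *)
  exists (invmx P), P, (K *m invmx P), alpha, beta; split; split=> //.
  + exact: Yp.1.
  + exact: Pp.1.
  + apply/psdP; split.
      by rewrite /sym_mx tr_block_mx trmx1 Pp.1 Yp.1.
    move=> X; rewrite -[X]vsubmxK -{1}[1%:M]trmx1 block_form mul1mx.
    exact: complete_square.
- move=> [Y [Z [L [alpha [beta H]]]]].
  exists (invmx Y), (L *m invmx Y); split; last split.
  + by apply: posdef_invmx; case: H => -[].
  + by move=> A B; exact: closed_loop H.
  + exact: trace_lt H.
move=> Y Z L alpha beta H K A B AB.
have Pp : posdef (invmx Y) by apply: posdef_invmx; case: H => -[].
have /posdefP[_ lyap] := closed_loop _ _ _ _ _ _ _ H AB.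
split.
  apply: (lyapunov_schur_stable Pp) => x /lyap.
  rewrite closed_loop_form subr_gt0; apply: le_lt_trans.
  by rewrite lerDl dot_ge0.
apply: le_lt_trans (lyapunov_h2norm Pp _) _.
  move=> x; have [->|/lyap] := eqVneq x 0; first by rewrite !mulmx0 !dot0l addr0.
  by rewrite closed_loop_form subr_gt0 => /ltW.
(* Positivity of [gamma] lets the bound on the trace pass to square roots. *)
rewrite -(ger0_norm (ltW hgamma)) -sqrtr_sqr ltr_sqrt ?exprn_gt0 //.
exact: trace_lt H.
Qed.
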